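(* Let $(\Omega,\mathcal F)$ be a measurable space, let $\mathcal C\subset\mathcal F$ be a sub-$\sigma$-algebra, and let $\rho:\mathbb F\to\mathbb R$ be a sublinear operator which is continuous from above on $\mathcal F$. Let $\xi\in\mathbb F$ and define $f:\mathbb C\to\mathbb R\cup\{-\infty\}$ by $f(\tilde\eta)=\inf_{\eta\in\mathbb C}\rho\big((\xi-\tilde\eta)\eta\big)$, and $\ker(f)=\{\tilde\eta\in\mathbb C: f(\tilde\eta)=0\}$. Then $$\ker(f)=\{E_P[\xi|\mathcal C]:P\in\mathcal P\},$$ that is, for $\tilde\eta\in\mathbb C$ one has $f(\tilde\eta)=0$ if and only if there is $P\in\mathcal P$ such that $\tilde\eta$ is a version of the conditional expectation $E_P[\xi|\mathcal C]$.
   Context: $\mathbb F$ denotes the set of all bounded $\mathcal F$-measurable real functions on $\Omega$ and $\mathbb C$ the set of all bounded $\mathcal C$-measurable real functions. A sublinear operator is a functional $\rho:\mathbb F\to\mathbb R$ such that: (i) $\rho(\xi_1)\ge\rho(\xi_2)$ if $\xi_1\ge\xi_2$; (ii) $\rho(c)=c$ for $c\in\mathbb R$; (iii) $\rho(\xi_1+\xi_2)\le\rho(\xi_1)+\rho(\xi_2)$ for all $\xi_1,\xi_2\in\mathbb F$; (iv) $\rho(\lambda\xi)=\lambda\rho(\xi)$ for $\lambda\ge0$. $\rho$ is continuous from above on $\mathcal F$ if for each sequence $(\xi_n)\subset\mathbb F$ with $\xi_n\downarrow0$ (pointwise) one has $\rho(\xi_n)\downarrow0$. $\mathcal P$ denotes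 the set of all linear functionals on $\mathbb F$ dominated by $\rho$. When $\rho$ is continuous from above, every element of $\mathcal P$ is the expectation $E_P$ under a probability measure $P$ on $(\Omega,\mathcal F)$ (and is identified with $P$), and $\rho(\xi)=\sup_{P\in\mathcal P}E_P[\xi]$ for all $\xi\in\mathbb F$. The conditional expectation $E_P[\xi|\mathcal C]$ is determined only up to $P$-null sets; the set $\{E_P[\xi|\mathcal C]:P\in\mathcal P\}$ consists of all bounded $\mathcal C$-measurable versions. *)

(* Defs.v *)
From HB Require Import structures.
From mathcomp Require Import all_boot all_order all_algebra.
From mathcomp Require Import all_classical all_reals all_analysis.
From mathcomp Require Import measurable_realfun.

Set Implicit Arguments.
Unset Strict Implicit.
Unset Printing Implicit Defensive.
Import Order.TTheory GRing.Theory Num.Theory.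
Import numFieldNormedType.Exports.

Local Open Scope classical_set_scope.
Local Open Scope ring_scope.

Section bounded_measurable.
Context (d : measure_display) (T : measurableType d) (R : realType).

Definition bmeas : {pred T -> R} :=
  mem [set f : T -> R |
    measurable_fun [set: T] f /\ [bounded f x | x in [set: T]]].

Lemma bounded_setTP (f : T -> R) :
  [bounded f x | x in [set: T]] <-> exists M, forall x, `|f x| <= M.
Proof.
split=> [[M [_ fM]]|[M fM]].
  by exists (M + 1) => x; apply: fM => //; rewrite ltrDl.
by exists M; split; [exact: num_real|move=> N MN x _; exact: le_trans (ltW MN)].
Qed.

Lemma bmeas_subring_closed : subring_closed bmeas.
Proof.
split=> [|f g|f g]; rewrite !inE/=.
- by split; [exact: measurable_cst|exact: bounded_cst].
- move=> [mf /bounded_setTP[M fM]] [mg /bounded_setTP[N gN]].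
  split; first exact: measurable_funB.
  apply/bounded_setTP; exists (M + N) => x /=.
  by apply: (le_trans (ler_normB _ _)); apply: lerD; [exact: fM|exact: gN].
- move=> [mf /bounded_setTP[M fM]] [mg /bounded_setTP[N gN]].
  split; first exact: measurable_funM.
  apply/bounded_setTP; exists (M * N) => x /=.
  by rewrite normrM; exact: ler_pM.
Qed.

HB.instance Definition _ :=
  GRing.isSubringClosed.Build (T -> R) bmeas bmeas_subring_closed.

Lemma bmeas_cst (c : R) : cst c \in bmeas.
Proof. by rewrite inE; split; [exact: measurable_cst|exact: bounded_cst]. Qed.

Lemma bmeas_scaler_closed : scaler_closed bmeas.
Proof. by move=> c f fb; exact: (rpredM (bmeas_cst c) fb). Qed.

HB.instance Definition _ :=
  GRing.isScaleClosed.Build R (T -> R) bmeas bmeas_scaler_closed.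

Record bmfun := BMFun { bmfun_fun :> T -> R; _ : bmfun_fun \in bmeas }.

HB.instance Definition _ := [isSub for bmfun_fun].
HB.instance Definition _ := [Choice of bmfun by <:].
HB.instance Definition _ :=
  GRing.SubChoice_isSubComPzRing.Build (T -> R) bmeas bmfun bmeas_subring_closed.
HB.instance Definition _ := [SubZmodule_isSubLmodule of bmfun by <:].

Definition bmfun_cst (c : R) : bmfun := BMFun (bmeas_cst c).

End bounded_measurable.

Section sublinear.
Context (d : measure_display) (T : measurableType d) (R : realType).
Implicit Types (rho : bmfun T R -> R) (xi eta : bmfun T R).

Definition sublinear_operator rho : Prop :=
  [/\ forall xi1 xi2, (forall x, xi2 x <= xi1 x) -> rho xi2 <= rho xi1,
      forall c, rho (bmfun_cst T c) = c,
      forall xi1 xi2, rho (xi1 + xi2) <= rho xi1 + rho xi2 &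
      forall (l : R) xi, 0 <= l -> rho (l *: xi) = l * rho xi].

Definition decreases_to0 (u : R^nat) : Prop :=
  nonincreasing_seq u /\ u @ \oo --> 0.

Definition continuous_from_above rho : Prop :=
  forall xi : nat -> bmfun T R,
    (forall x, decreases_to0 (fun n => xi n x)) ->
    decreases_to0 (fun n => rho (xi n)).

Definition dominated_functionals rho : set {scalar (bmfun T R)} :=
  [set L : {scalar (bmfun T R)} | forall xi, L xi <= rho xi].

Definition is_expectation (P : probability T R) (L : {scalar (bmfun T R)}) :
    Prop :=
  forall xi, (L xi)%:E = 'E_P[xi]%E.

End sublinear.

Section conditional.
Context (d : measure_display) (T : measurableType d) (R : realType).
Variable C : set (set T).
Implicit Types (rho : bmfun T R -> R) (xi eta : bmfun T R).

Definition is_sub_sigma_algebra : Prop :=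
  sigma_algebra [set: T] C /\ C `<=` measurable.

(* When C is a sigma-algebra, the measurable sets of [g_sigma_algebraType C]
   are exactly the elements of C. *)
Definition bmfun_sub : set (bmfun T R) :=
  [set eta : bmfun T R |
    measurable_fun [set: g_sigma_algebraType C]
      (eta : g_sigma_algebraType C -> R)].

(* Never +oo, since eta = 0 is allowed. *)
Definition inf_rho rho xi (etat : bmfun T R) : \bar R :=
  ereal_inf [set (rho ((xi - etat) * eta))%:E | eta in bmfun_sub].

Definition ker_inf_rho rho xi : set (bmfun T R) :=
  [set etat | bmfun_sub etat /\ inf_rho rho xi etat = 0%E].

Definition is_cond_expectation (P : probability T R) xi eta : Prop :=
  bmfun_sub eta /\
  forall A, C A ->
    (\int[P]_(x in A) (eta x)%:E = \int[P]_(x in A) (xi x)%:E)%E.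

(* An element of [dominated_functionals rho] is a linear functional; it is
   identified with the probability measure P for which it is E_P. *)
Definition cond_expectations rho xi : set (bmfun T R) :=
  [set eta | exists L : {scalar (bmfun T R)}, dominated_functionals rho L /\
     exists P : probability T R,
       is_expectation P L /\ is_cond_expectation P xi eta].

End conditional.

(* Main.v *)
Require Import Defs.
From HB Require Import structures.
From mathcomp Require Import all_boot all_order all_algebra finmap.
From mathcomp Require Import all_classical all_reals all_analysis.
From mathcomp Require Import measurable_realfun ring lra.

(** Why the theorem holds.

Let [etat] be bounded and [C]-measurable. The products [(xi - etat) * eta],
with [eta] bounded and [C]-measurable, form a linear subspace [V] of the bounded
measurable functions, and [f etat = 0] says exactly that [rho >= 0] on [V]: the
infimum is at most [rho 0 = 0], since [eta = 0] is admitted.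

If [rho >= 0] on [V], the zero functional on [V] is dominated by [rho]; by
Hahn-Banach ([hahn_banach_cone]) there is a linear [L <= rho] on the whole space
that vanishes on [V]. Continuity from above passes from [rho] to [L], so [L] is
the expectation under a probability [P] ([dominated_expectation], a Daniell
representation), and [L ((xi - etat) * \1_A) = 0] for [A] in [C] says that [etat]
is a version of the conditional expectation of [xi].

Conversely, if [etat] is such a version for some [P] with [E_P <= rho], then
[eta |-> E_P ((xi - etat) * eta)] vanishes on the indicators of [C], hence on all
bounded [C]-measurable [eta] ([vanish_bmfun_sub]), so that [rho] is at least
[0 = E_P ((xi - etat) * eta)] at every point of [V].

The step from indicators to bounded functions occurs twice, once for [C] and
once, to identify [L] with [E_P], for the whole sigma-algebra. Both are instances
of [vanish_bmfun_sub], for which the functional need not be positive: it suffices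
that it be linear and tend to [0] along sequences decreasing to [0]. *)

Set Implicit Arguments.
Unset Strict Implicit.
Unset Printing Implicit Defensive.
Import Order.TTheory GRing.Theory Num.Theory.
Import numFieldNormedType.Exports.

Local Open Scope classical_set_scope.
Local Open Scope ring_scope.

(** * Hahn-Banach by minimal sublinear functionals *)

Section hahn_banach.
Context (R : realType) (E : lmodType R).
Implicit Types (p q : E -> R) (K : set (E * R)).

Definition sublinear p : Prop :=
  (forall x y, p (x + y) <= p x + p y) /\
  (forall l x, 0 <= l -> p (l *: x) = l * p x).

Lemma sublinear0 p : sublinear p -> p 0 = 0.
Proof. by move=> [_ pZ]; have := pZ 0 0 (lexx 0); rewrite scale0r mul0r. Qed.

Lemma sublinear_oppr_le p x : sublinear p -> - p (- x) <= p x.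
Proof.
move=> sp; have := sp.1 x (- x); rewrite subrr (sublinear0 sp); lra.
Qed.

Lemma sublinearP p : p 0 = 0 -> (forall x y, p (x + y) <= p x + p y) ->
  (forall l x, 0 < l -> p (l *: x) <= l * p x) -> sublinear p.
Proof.
move=> p0 pD pZ; split=> // l x; rewrite le_eqVlt => /predU1P[<-|l0].
  by rewrite scale0r mul0r.
apply/eqP; rewrite eq_le pZ//= -ler_pdivlMl//.
have := pZ l^-1 (l *: x); rewrite invr_gt0 scalerA mulVf ?gt_eqF// scale1r.
exact.
Qed.

(** A convex cone of pairs [(v, c)], each of them a demand [c <= L v] on a linear
functional [L <= q]; the last field is the necessary condition [c <= q v]. *)
Record minorant_cone q K : Prop := MinorantCone {
  cone0 : K (0, 0) ;
  coneD : forall k k', K k -> K k' -> K (k.1 + k'.1, k.2 + k'.2) ;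
  coneZ : forall l k, 0 < l -> K k -> K (l *: k.1, l * k.2) ;
  cone_le : forall k, K k -> k.2 <= q k.1 }.

(** The largest sublinear functional below [q] whose dominated linear functionals
satisfy the demands of [K]: [L <= q] and [c <= L v] give
[L x = L (x + v) - L v <= q (x + v) - c]. *)
Definition tilt q K x : R := inf [set q (x + k.1) - k.2 | k in K].

Section tilt.
Context (q : E -> R) (K : set (E * R)).
Hypotheses (sq : sublinear q) (cK : minorant_cone q K).

Lemma tilt_lbound x : lbound [set q (x + k.1) - k.2 | k in K] (- q (- x)).
Proof.
move=> _ [k Kk <-]; have := sq.1 (x + k.1) (- x).
rewrite addrAC subrr add0r => qk; have := cone_le cK Kk; lra.
Qed.

Lemma tilt_le x k : K k -> tilt q K x <= q (x + k.1) - k.2.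
Proof.
move=> Kk; apply: ge_inf; last by exists k.
by exists (- q (- x)); exact: tilt_lbound.
Qed.

Lemma le_tilt x a : (forall k, K k -> a <= q (x + k.1) - k.2) ->
  a <= tilt q K x.
Proof.
move=> aK; apply: lb_le_inf; last by move=> _ [k Kk <-]; exact: aK.
by exists (q (x + 0) - 0), (0, 0) => //; exact: (cone0 cK).
Qed.

Lemma tilt_le_id x : tilt q K x <= q x.
Proof. by have := tilt_le x (cone0 cK); rewrite /= addr0 subr0. Qed.

Lemma tilt_oppr_le k : K k -> tilt q K (- k.1) <= - k.2.
Proof.
by move=> /(tilt_le (- k.1)); rewrite addNr (sublinear0 sq) add0r.
Qed.

Lemma tilt_sublinear : sublinear (tilt q K).
Proof.
apply: sublinearP.
- apply/eqP; rewrite eq_le; apply/andP; split.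
    by rewrite (le_trans (tilt_le_id 0))// (sublinear0 sq).
  by apply: le_tilt => k Kk; rewrite add0r subr_ge0; exact: (cone_le cK Kk).
- move=> x y; rewrite -lerBlDr; apply: le_tilt => k Kk.
  rewrite lerBlDr -lerBlDl; apply: le_tilt => k' Kk'.
  have := tilt_le (x + y) (coneD cK Kk Kk'); rewrite /= addrACA => h.
  by have := sq.1 (x + k.1) (y + k'.1); lra.
- move=> l x l0; rewrite -ler_pdivrMl//; apply: le_tilt => k Kk.
  rewrite ler_pdivrMl//; have := tilt_le (l *: x) (coneZ cK l0 Kk).
  rewrite /= -scalerDr (sq.2 _ _ (ltW l0)) mulrBr.
  exact.
Qed.

End tilt.

(** Along a chain, subadditivity survives the infimum because any two members
[q], [r] can be replaced by the smaller one:
[min q r (x + y) <= min q r x + min q r y <= q x + r y]. The infimum is finite, as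
all members are bounded below at [x] by [- p (- x)]. *)
Lemma inf_chain_sublinear p (A : set (E -> R)) : A p ->
  (forall q, A q -> sublinear q) ->
  (forall q r, A q -> A r -> (forall x, q x <= r x) \/ (forall x, r x <= q x)) ->
  (forall q, A q -> forall x, q x <= p x) ->
  sublinear (fun x => inf [set q x | q in A]) /\
  (forall q, A q -> forall x, inf [set r x | r in A] <= q x).
Proof.
move=> Ap As Atot Alep; set m := fun x => _.
have mA q : A q -> forall x, m x <= q x.
  move=> Aq x; apply: ge_inf; last by exists q.
  exists (- p (- x)) => _ [r Ar <-].
  by apply: le_trans (sublinear_oppr_le x (As _ Ar)); rewrite lerN2 Alep.
have mge x a : (forall q, A q -> a <= q x) -> a <= m x.
  move=> aA; apply: lb_le_inf; first by exists (p x), p.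
  by move=> _ [q Aq <-]; exact: aA.
split=> //; apply: sublinearP.
- apply/eqP; rewrite eq_le; apply/andP; split.
    by rewrite -(sublinear0 (As _ Ap)) mA.
  by apply: mge => q Aq; rewrite (sublinear0 (As _ Aq)).
- move=> x y; rewrite -lerBlDr; apply: (mge) => q Aq.
  rewrite lerBlDr -lerBlDl; apply: mge => r Ar; rewrite lerBlDl.
  have [qr|rq] := Atot _ _ Aq Ar.
    by rewrite (le_trans (mA _ Aq _))// (le_trans ((As _ Aq).1 _ _))// lerD2l.
  by rewrite (le_trans (mA _ Ar _))// (le_trans ((As _ Ar).1 _ _))// lerD2r.
- move=> l x l0; rewrite -ler_pdivrMl//; apply: mge => q Aq.
  by rewrite ler_pdivrMl// -((As _ Aq).2 _ _ (ltW l0)) mA.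
Qed.

Lemma minimal_sublinear p : sublinear p ->
  exists q, [/\ sublinear q, forall x, q x <= p x &
    forall r, sublinear r -> (forall x, r x <= q x) -> r = q].
Proof.
move=> sp.
pose S := {q : E -> R | sublinear q /\ forall x, q x <= p x}.
pose le_rev (q r : S) := `[< forall x, sval r x <= sval q x >].
have [| | | |[q [sq qp]] qmin] := @Zorn S le_rev.
- by move=> q; apply/asboolP.
- move=> q r s /asboolP qr /asboolP rs; apply/asboolP => x.
  exact: le_trans (rs x) (qr x).
- move=> [q Sq] [r Sr] /asboolP/= qr /asboolP/= rq; apply: eq_exist.
  by apply/funext => x; apply/eqP; rewrite eq_le qr rq.
- move=> A Atot.
  (* Adding [p] makes the chain nonempty without changing its lower bounds. *)
  pose B := p |` [set sval q | q in A].
  have Bs q : B q -> sublinear q by move=> [->//|[[r [sr ?]] _ <-]].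
  have Bp q : B q -> forall x, q x <= p x by move=> [->//|[[r [sr ?]] _ <-]].
  have [||//|sm mB] := @inf_chain_sublinear p B _ Bs.
    by left.
  + move=> q r [->|[q' Aq <-]]; first by move=> Br; right; exact: Bp.
    move=> [->|[r' Ar <-]]; first by left=> x; have [] := svalP q'.
    by have [/asboolP|/asboolP] := Atot _ _ Aq Ar; [right|left].
  + have mp : forall x, inf [set r x | r in B] <= p x by apply: mB; left.
    exists (exist _ (fun x => inf [set r x | r in B]) (conj sm mp)) => q Aq.
    by apply/asboolP => x /=; apply: mB; right; exists q.
- exists q; split=> // r sr rq.
  have rp x : r x <= p x := le_trans (rq x) (qp x).
  pose r' : S := exist _ r (conj sr rp).
  have /(congr1 sval)// : r' = exist _ q (conj sq qp).
  by apply: qmin; apply/asboolP.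
Qed.

(** Tilting [q] by the ray through [(y, q y)] does not change a minimal [q], and
the resulting inequality [q x <= q (x + y) - q y] is superadditivity. *)
Lemma minimal_sublinear_linear q : sublinear q ->
  (forall r, sublinear r -> (forall x, r x <= q x) -> r = q) ->
  scalar q.
Proof.
move=> sq qmin.
have qD x y : q (x + y) = q x + q y.
  apply/eqP; rewrite eq_le sq.1 /=.
  pose K := [set (t *: y, t * q y) | t in [set t : R | 0 <= t]].
  have cK : minorant_cone q K.
    split.
    - by exists 0 => /=; rewrite ?scale0r ?mul0r.
    - move=> _ _ [s s0 <-] [t t0 <-]; exists (s + t); first exact: addr_ge0.
      by rewrite /= scalerDl mulrDl.
    - move=> l _ l0 [s s0 <-]; exists (l * s).
        by rewrite /= mulr_ge0// ltW.
      by rewrite /= scalerA mulrA.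
    - by move=> _ [s s0 <-]; rewrite /= sq.2.
  have tq := qmin _ (tilt_sublinear sq cK) (tilt_le_id sq cK).
  have Ky : K (y, q y) by exists 1 => /=; rewrite ?ler01// scale1r mul1r.
  by have := tilt_le sq cK x Ky; rewrite tq /=; lra.
have qN x : q (- x) = - q x.
  by apply/eqP; rewrite -addr_eq0 -qD addNr (sublinear0 sq).
move=> a x y; rewrite qD; congr (_ + _).
have [a0|a0] := leP 0 a; first by rewrite (sq.2 _ _ a0).
by rewrite -[a]opprK scaleNr qN sq.2 ?mulNr// oppr_ge0 ltW.
Qed.

Definition scalar_of (f : E -> R) (lf : scalar f) : {scalar E} :=
  HB.pack f (GRing.isLinear.Build R E R _ f lf).

(** A minimal sublinear functional below the tilt of [p] by [V * {0}] is linear,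
and its value at [- v] is at most [p (- v + v) = 0] for [v] in [V]. On a subspace
[V] the conclusion is that [L] vanishes. *)
Lemma hahn_banach_cone p (V : set E) : sublinear p ->
  V 0 -> (forall u v, V u -> V v -> V (u + v)) ->
  (forall l v, 0 < l -> V v -> V (l *: v)) -> (forall v, V v -> 0 <= p v) ->
  exists L : {scalar E},
    (forall x, L x <= p x) /\ (forall v, V v -> 0 <= L v).
Proof.
move=> sp V0 VD VZ pV.
pose K := [set (v, 0 : R) | v in V].
have cK : minorant_cone p K.
  split.
  - by exists 0.
  - by move=> _ _ [u Vu <-] [v Vv <-]; exists (u + v); [exact: VD|rewrite addr0].
  - by move=> l _ l0 [v Vv <-]; exists (l *: v); [exact: VZ|rewrite mulr0].
  - by move=> _ [v Vv <-]; exact: pV.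
have [q [sq qp qmin]] := minimal_sublinear (tilt_sublinear sp cK).
exists (scalar_of (minimal_sublinear_linear sq qmin)); split=> [x|v Vv].
  exact: le_trans (qp x) (tilt_le_id sp cK x).
rewrite -oppr_le0 -raddfN /=; apply: le_trans (qp _) _.
have : K (v, 0) by exists v.
by move=> /(tilt_oppr_le sp cK); rewrite oppr0.
Qed.

End hahn_banach.

(** * Bounded measurable functions and their indicators *)

Section bmfun_theory.
Context (d : measure_display) (T : measurableType d) (R : realType).
Implicit Types (f : T -> R) (xi eta : bmfun T R) (A : set T).

Lemma bmfunP (xi : bmfun T R) :
  measurable_fun [set: T] xi /\ exists M, forall x, `|xi x| <= M.
Proof.
case: xi => f fb /=; have : f \in @bmeas _ T R by exact: fb.
by rewrite inE => -[mf /bounded_setTP].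
Qed.

Lemma measurable_bmfun (xi : bmfun T R) : measurable_fun [set: T] xi.
Proof. exact: (bmfunP xi).1. Qed.

Lemma bmfun_ext xi eta : xi =1 eta -> xi = eta.
Proof. by move=> h; apply/val_inj/funext. Qed.

Lemma bmfunD xi eta x : (xi + eta) x = xi x + eta x. Proof. by []. Qed.
Lemma bmfunN xi x : (- xi) x = - xi x. Proof. by []. Qed.
Lemma bmfunM xi eta x : (xi * eta) x = xi x * eta x. Proof. by []. Qed.
Lemma bmfunZ (a : R) xi x : (a *: xi) x = a * xi x. Proof. by []. Qed.

Lemma bmfun_sum (I : Type) (r : seq I) (P : pred I) (F : I -> bmfun T R) x :
  (\sum_(i <- r | P i) F i) x = \sum_(i <- r | P i) F i x.
Proof. exact: (big_morph (fun h : bmfun T R => h x)). Qed.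

(** Total in [f], with value [0] outside the bounded measurable functions, so that
indicators can be formed without a measurability proof as argument. *)
Definition to_bmfun f : bmfun T R := insubd 0 f.

Lemma to_bmfunE f M : measurable_fun [set: T] f -> (forall x, `|f x| <= M) ->
  to_bmfun f = f :> (T -> R).
Proof.
move=> mf fM; apply: insubdK; rewrite inE; split=> //.
by apply/bounded_setTP; exists M.
Qed.

Definition bm_indic A : bmfun T R := to_bmfun \1_A.

Lemma bm_indicE A : measurable A -> bm_indic A = \1_A :> (T -> R).
Proof.
move=> mA; apply: (@to_bmfunE _ 1); first exact/measurable_indicP.
by move=> x; rewrite indicE ger0_norm ?ler0n// lern1 leq_b1.
Qed.

Lemma bm_indic_ge0 A x : 0 <= bm_indic A x.
Proof.
rewrite /bm_indic /to_bmfun /insubd; case: insubP => //= f _ ->.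
by rewrite indicE ler0n.
Qed.

End bmfun_theory.

(** * Functionals vanishing on indicators *)

Section functionals.
Context (d : measure_display) (T : measurableType d) (R : realType).
Implicit Types (xi eta : bmfun T R) (L : {scalar (bmfun T R)}).

(** Continuity from above for functionals that may change sign: the values tend
to [0], with no monotonicity. *)
Definition vanishing_at0 (L : bmfun T R -> R) : Prop :=
  forall u : nat -> bmfun T R, (forall x, decreases_to0 (fun n => u n x)) ->
    L (u n) @[n --> \oo] --> 0.

Lemma decreases_to0_ge0 (u : R^nat) n : decreases_to0 u -> 0 <= u n.
Proof.
move=> [ud u0]; rewrite -(cvg_lim _ u0)//.
by apply: nonincreasing_cvgn_ge => //; apply/cvg_ex; exists 0.
Qed.

Lemma simple_vanish L (B : set_system T) (h : bmfun T R) :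
  finite_set (range h) -> (forall y, B (h @^-1` [set y])) ->
  (forall A, B A -> measurable A) -> (forall A, B A -> L (bm_indic R A) = 0) ->
  L h = 0.
Proof.
move=> fh Bh Bm LB.
pose a y : bmfun T R := bm_indic R (h @^-1` [set y]).
have -> : h = \sum_(y <- fset_set (range h)) y *: a y.
  apply: bmfun_ext => x; rewrite bmfun_sum.
  rewrite (big_fsetD1 (h x)); last by rewrite in_fset_set// inE; exists x.
  rewrite bmfunZ bm_indicE; last by apply/Bm/Bh.
  rewrite indicE mem_set// mulr1.
  rewrite big_seq big1 => [|y]; first by rewrite /= addr0.
  rewrite !inE => /andP[/eqP yh _].
  rewrite bmfunZ bm_indicE; last by apply/Bm/Bh.
  by rewrite indicE memNset ?mulr0// => /= /esym.
by rewrite raddf_sum big1// => y _ /=; rewrite linearZ /= LB ?mulr0.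
Qed.

Import HBNNSimple.

(** A nonnegative [C]-measurable function is the increasing limit of [C]-simple
functions, on which [L] is [0] by linearity; the remainders decrease to [0], so
the value of [L], which they all share, is [0]. A bounded function becomes
nonnegative after adding a constant, a multiple of the indicator of the space. *)
Lemma vanish_bmfun_sub (C : set_system T) L : is_sub_sigma_algebra C ->
  vanishing_at0 L -> (forall A, C A -> L (bm_indic R A) = 0) ->
  forall eta, bmfun_sub C eta -> L eta = 0.
Proof.
move=> [sC Cm] L0 LC eta meta.
have [_ [M etaM]] := bmfunP eta.
pose U := g_sigma_algebraType C.
have UC (A : set U) : measurable A -> C A by rewrite /measurable/= sigma_algebra_id.
pose g (x : U) : R := eta x + M.
have g0 x : 0 <= g x.
  by rewrite /g -lerBlDr sub0r; have := etaM x; rewrite ler_norml => /andP[].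
have g0E (x : U) : [set: U] x -> (0 <= (EFin \o g) x)%E by rewrite /= lee_fin.
have mg : measurable_fun [set: U] (EFin \o g).
  by apply/measurable_EFinP; apply: measurable_funD => //; exact: measurable_cst.
pose h n : {nnsfun U >-> R} := nnsfun_approx measurableT mg n.
have h_nd : nondecreasing_seq (h : (U -> R)^nat) by exact: nd_nnsfun_approx.
have hcvg x : h n x @[n --> \oo] --> g x.
  exact: (fine_cvg (cvg_nnsfun_approx measurableT mg g0E (x:=x) I)).
have hg n x : h n x <= g x.
  rewrite -(cvg_lim _ (hcvg x))//.
  apply: (@nondecreasing_cvgn_le _ (fun m => h m x)).
    by move=> a b ab; exact/lefP/h_nd.
  by apply/cvg_ex; exists (g x); exact: hcvg.
have hC n y : C (h n @^-1` [set y]) by exact/UC.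
have mh n : measurable_fun [set: T] (h n : T -> R).
  move=> _ Y mY; rewrite setTI; apply/Cm/UC.
  by rewrite -[X in measurable X]setTI; exact: measurable_funP.
have hM n x : `|h n x| <= M + M.
  rewrite ger0_norm//; apply: le_trans (hg n x) _; rewrite lerD2r.
  exact: le_trans (ler_norm _) (etaM x).
pose k n : bmfun T R := to_bmfun (h n : T -> R).
have kE n : k n = h n :> (T -> R) by apply: (to_bmfunE (mh n) (hM n)).
have Lk n : L (k n) = 0.
  apply: (@simple_vanish L C) => //.
  - rewrite kE; exact: (fimfunP (h n)).
  - by move=> y; rewrite kE; exact: hC.
have CT : C [set: T] by rewrite -setC0 -setTD; case: sC => C0 CD _; exact: CD.
have LM : L (bmfun_cst T M) = 0.
  rewrite (_ : bmfun_cst T M = M *: bm_indic R [set: T]).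
    by rewrite linearZ/= LC ?mulr0.
  by apply: bmfun_ext => x; rewrite bmfunZ bm_indicE// indicE in_setT mulr1.
have : L (eta + bmfun_cst T M - k n) @[n --> \oo] --> 0.
  apply: L0 => x; split.
  - move=> m n mn; rewrite !(bmfunD, bmfunN) !kE lerD2l lerN2.
    exact/lefP/h_nd.
  - rewrite [X in X @ _](_ : _ = (fun n => g x - h n x)); last first.
      by apply/funext => n; rewrite !(bmfunD, bmfunN) kE.
    by rewrite -(subrr (g x)); apply: cvgB; [exact: cvg_cst|exact: hcvg].
under eq_fun do rewrite raddfB raddfD /= Lk LM subr0 addr0.
by move=> /cvg_lim => /(_ (@Rhausdorff R)) <-; rewrite lim_cst.
Qed.

End functionals.

(** * Representation of continuous positive functionals *)

Section representation.
Context (d : measure_display) (T : measurableType d) (R : realType).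
Variable L : {scalar (bmfun T R)}.
Hypotheses (L_ge0 : forall xi : bmfun T R, (forall x, 0 <= xi x) -> 0 <= L xi)
  (L_vanish : vanishing_at0 L).

Definition functional_measure (A : set T) : \bar R := (L (bm_indic R A))%:E.

Let mu := functional_measure.

Let mu0 : mu set0 = 0%E.
Proof.
rewrite /mu /functional_measure (_ : bm_indic R set0 = 0) ?raddf0//.
by apply: bmfun_ext => x; rewrite bm_indicE// indic0.
Qed.

Let mu_ge0 A : (0 <= mu A)%E.
Proof. by rewrite lee_fin; apply: L_ge0 => x; exact: bm_indic_ge0. Qed.

(** The remainder of the series of indicators is a sequence of functions that
decreases to [0], and [L] tends to [0] along it. The pointwise limit comes from
the countable additivity of the Dirac measure at [x], which maps [A] to
[\1_A x]. *)
Let mu_semi_sigma_additive : semi_sigma_additive mu.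
Proof.
move=> F mF tF mUF.
pose u n : bmfun T R :=
  bm_indic R (\bigcup_k F k) - \sum_(0 <= i < n) bm_indic R (F i).
have uE n x : u n x = \1_(\bigcup_k F k) x - \sum_(0 <= i < n) \1_(F i) x.
  rewrite bmfunD bmfunN bmfun_sum bm_indicE//; congr (_ - _).
  by apply: eq_bigr => i _; rewrite bm_indicE.
have u0 x : decreases_to0 (fun n => u n x).
  split.
    apply/nonincreasing_seqP => n; rewrite !uE lerD2l lerN2.
    by rewrite big_nat_recr//= lerDl indicE ler0n.
  have h : (\sum_(0 <= i < n) (\1_(F i) x : R)%:E)%E @[n --> \oo] -->
      (\1_(\bigcup_k F k) x : R)%:E.
    exact: (@measure_semi_sigma_additive _ _ _ (@dirac d T x R) F mF tF mUF).
  have {}h := fine_cvg h.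
  rewrite [X in X @ _](_ : _ = (fun n => \1_(\bigcup_k F k) x -
      fine (\sum_(0 <= i < n) (\1_(F i) x)%:E)%E)).
    rewrite -(subrr (\1_(\bigcup_k F k) x)).
    by apply: cvgB; [exact: cvg_cst|exact: h].
  by apply/funext => n; rewrite uE sumEFin.
have := L_vanish u0.
rewrite [X in X @ _](_ : _ = (fun n => L (bm_indic R (\bigcup_k F k)) -
   \sum_(0 <= i < n) L (bm_indic R (F i)))); last first.
  by apply/funext => n; rewrite raddfB raddf_sum.
move=> h; rewrite /mu /functional_measure.
under eq_fun do rewrite sumEFin.
apply/fine_cvgP; split; first exact: nearW.
rewrite [X in X @ _](_ : _ = (fun n => L (bm_indic R (\bigcup_k F k)) -
   (L (bm_indic R (\bigcup_k F k)) - \sum_(0 <= i < n) L (bm_indic R (F i)))));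
  last by apply/funext => n /=; rewrite subKr.
by rewrite -[X in _ --> X]subr0; apply: cvgB h; exact: cvg_cst.
Qed.

HB.instance Definition _ := isMeasure.Build d T R functional_measure
  mu0 mu_ge0 mu_semi_sigma_additive.

Hypothesis L1 : L (bmfun_cst T 1) = 1.

Let muT : functional_measure [set: T] = 1%E.
Proof.
rewrite /functional_measure -L1; congr (L _)%:E; apply: bmfun_ext => x.
by rewrite bm_indicE// indicT.
Qed.

HB.instance Definition _ := Measure_isProbability.Build d T R
  functional_measure muT.

Definition functional_probability : probability T R := functional_measure.

End representation.

Section expectation.
Context (d : measure_display) (T : measurableType d) (R : realType).
Variable P : probability T R.

Lemma bmfun_integrable (xi : bmfun T R) A : measurable A ->
  P.-integrable A (EFin \o xi).
Proof.
move=> mA; have [mxi [M xiM]] := bmfunP xi.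
apply: measurable_bounded_integrable => //.
- by rewrite (le_lt_trans (probability_le1 _ _))// ltry.
- exact: measurable_funTS.
- exists M; split; first exact: num_real.
  by move=> N MN x _; exact: le_trans (xiM x) (ltW MN).
Qed.

Definition bm_expectation (xi : bmfun T R) : R := fine ('E_P[xi])%E.

Lemma bm_expectationE (xi : bmfun T R) :
  (bm_expectation xi)%:E = (\int[P]_x (xi x)%:E)%E.
Proof.
rewrite /bm_expectation unlock fineK//.
by apply: integrable_fin_num => //; exact: bmfun_integrable.
Qed.

Lemma is_expectationE (L : {scalar (bmfun T R)}) :
  is_expectation P L -> L =1 bm_expectation.
Proof.
by move=> PL xi; apply: EFin_inj; rewrite PL unlock bm_expectationE.
Qed.

Lemma bm_expectation_linear : scalar bm_expectation.
Proof.
move=> a xi eta; apply: EFin_inj; rewrite EFinD EFinM !bm_expectationE.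
rewrite -integralZl//; last exact: bmfun_integrable.
rewrite -integralD//; last exact: bmfun_integrable.
exact: (integrableZl measurableT a (bmfun_integrable xi measurableT)).
Qed.

(** Dominated convergence, with the first term of the sequence as bound. *)
Lemma bm_expectation_vanish : vanishing_at0 bm_expectation.
Proof.
move=> u u0; apply: (@fine_cvg _ _ _ _ (fun n => (bm_expectation (u n))%:E)).
under eq_fun do rewrite bm_expectationE.
have := @dominated_convergence _ _ _ P [set: T] measurableT
  (fun n x => (u n x)%:E) (cst 0%E) (EFin \o u 0).
rewrite integral0; case => //.
- by move=> n; apply/measurable_EFinP; exact: measurable_bmfun.
- by apply: aeW => x _; apply/fine_cvgP; split; [exact: nearW|exact: (u0 x).2].
- exact: bmfun_integrable.
- apply: aeW => x n _; rewrite lee_fin ger0_norm; last first.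
    exact: (decreases_to0_ge0 _ (u0 x)).
  exact: (u0 x).1.
Qed.

Lemma bm_expectation_indic A : measurable A ->
  (bm_expectation (bm_indic R A))%:E = P A.
Proof.
by move=> mA; rewrite bm_expectationE bm_indicE// integral_indic// setIT.
Qed.

Lemma bm_expectation_setI (xi : bmfun T R) A : measurable A ->
  (bm_expectation (xi * bm_indic R A))%:E = (\int[P]_(x in A) (xi x)%:E)%E.
Proof.
move=> mA; rewrite bm_expectationE [RHS]integral_mkcond; apply: eq_integral.
move=> x _; rewrite bmfunM bm_indicE// patchE indicE.
by case: (x \in A); rewrite ?mulr1 ?mulr0.
Qed.

End expectation.

(** * Linear functionals dominated by a sublinear operator *)

Section dominated.
Context (d : measure_display) (T : measurableType d) (R : realType).
Variables (rho : bmfun T R -> R) (L : {scalar (bmfun T R)}).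
Hypotheses (hrho : sublinear_operator rho) (hL : dominated_functionals rho L).

Lemma dominated_ge0 (xi : bmfun T R) : (forall x, 0 <= xi x) -> 0 <= L xi.
Proof.
case: hrho => [rho_le rho_cst _ _] xi0.
rewrite -oppr_le0 -raddfN; apply: le_trans (hL _) _.
rewrite -(rho_cst 0); apply: rho_le => x.
by rewrite bmfunN oppr_le0.
Qed.

Lemma dominated1 : L (bmfun_cst T 1) = 1.
Proof.
case: hrho => [_ rho_cst _ _].
have := hL (bmfun_cst T 1); have := hL (bmfun_cst T (- 1)).
rewrite !rho_cst (_ : bmfun_cst T (- 1) = - bmfun_cst T 1).
  by rewrite raddfN /=; lra.
exact: bmfun_ext.
Qed.

Lemma dominated_le (xi eta : bmfun T R) : (forall x, xi x <= eta x) ->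
  L xi <= L eta.
Proof.
move=> h; rewrite -subr_ge0 -raddfB; apply: dominated_ge0 => x.
by rewrite bmfunD bmfunN subr_ge0.
Qed.

Hypothesis hcont : continuous_from_above rho.

Lemma dominated_vanish : vanishing_at0 L.
Proof.
move=> u u0; apply: (@squeeze_cvgr _ _ _ _ (cst 0) (fun n => rho (u n))).
- apply: nearW => n; rewrite hL andbT; apply: dominated_ge0 => x.
  exact: decreases_to0_ge0 (u0 x).
- exact: cvg_cst.
- exact: (hcont u0).2.
Qed.

(** Multiplication by a bounded [g] destroys positivity of [L] but not the
continuity: with [`|g| <= M], the value at [u n >= 0] is squeezed between
[- M * L (u n)] and [M * L (u n)]. *)
Lemma dominated_mul_vanish (g : bmfun T R) :
  vanishing_at0 (fun eta => L (g * eta)).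
Proof.
move=> u u0; have [_ [M gM]] := bmfunP g.
have Lu0 : M * L (u n) @[n --> \oo] --> 0.
  by rewrite -(mulr0 M); apply: cvgM; [exact: cvg_cst|exact: dominated_vanish].
have un0 n x := decreases_to0_ge0 n (u0 x).
apply: (@squeeze_cvgr _ _ _ _ (fun n => - (M * L (u n))) (fun n => M * L (u n))).
- apply: nearW => n; rewrite -mulNr -!linearZ/=; apply/andP.
  split; apply: dominated_le => x; rewrite bmfunM bmfunZ ler_wpM2r//;
    by have := gM x; rewrite ler_norml => /andP[].
- by rewrite -[0]oppr0; exact: cvgN.
- exact: Lu0.
Qed.

Lemma mul_linear (g : bmfun T R) : scalar (fun eta => L (g * eta)).
Proof.
move=> a eta1 eta2; rewrite mulrDr raddfD; congr (_ + _).
rewrite -linearZ; congr (L _); apply: bmfun_ext => x.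
by rewrite !(bmfunM, bmfunZ) mulrCA.
Qed.

(** [P A] is the value of [L] at the indicator of [A]; the difference of [L] and
[E_P] vanishes on indicators, hence everywhere. *)
Lemma dominated_expectation : exists P : probability T R, is_expectation P L.
Proof.
exists (functional_probability dominated_ge0 dominated_vanish dominated1).
set P := functional_probability _ _ _ => xi.
have lin : scalar (fun eta => L eta - bm_expectation P eta).
  move=> a eta1 eta2; rewrite linearP bm_expectation_linear /=; ring.
pose D := scalar_of lin.
suff : D xi = 0.
  move=> /eqP; rewrite subr_eq0 => /eqP ->.
  by rewrite bm_expectationE unlock.
apply: (@vanish_bmfun_sub _ _ _ measurable) => //.
- by split=> //; exact: sigma_algebra_measurable.
- move=> u u0; rewrite -(subrr 0); apply: cvgB; first exact: dominated_vanish.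
  exact: bm_expectation_vanish.
- move=> A mA; apply/eqP; rewrite subr_eq0; apply/eqP/EFin_inj.
  by rewrite bm_expectation_indic.
- move=> _ Y mY; apply: sub_sigma_algebra.
  exact: measurable_bmfun.
Qed.

End dominated.

(** * The kernel is the set of conditional expectations *)

Theorem lemma4p1 (R : realType) (d : measure_display) (T : measurableType d)
    (C : set (set T)) (hC : is_sub_sigma_algebra C)
    (rho : bmfun T R -> R) (hrho : sublinear_operator rho)
    (hcont : continuous_from_above rho) (xi : bmfun T R) :
  ker_inf_rho C rho xi = cond_expectations C rho xi.
Proof.
have srho : sublinear rho by case: hrho => _ _ rhoD rhoZ; split.
have C_indic A : C A -> bmfun_sub C (bm_indic R A).
  move=> CA; rewrite /bmfun_sub /= bm_indicE; last exact: hC.2.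
  apply/(@measurable_indicP _ (g_sigma_algebraType C)).
  exact: sub_sigma_algebra.
apply/seteqP; split=> etat.
- move=> [Cetat inf0].
  pose V := [set (xi - etat) * eta | eta in bmfun_sub C].
  have V_ge0 v : V v -> 0 <= rho v.
    move=> [eta Ceta <-]; rewrite -lee_fin -[leLHS]inf0.
    by apply: ereal_inf_lbound; exists eta.
  have [||||L [Lrho LV]] := @hahn_banach_cone R (bmfun T R) rho V _ _ _ _ V_ge0.
  + exact: srho.
  + exists 0; last by rewrite mulr0.
    exact: measurable_cst.
  + move=> _ _ [a Ca <-] [b Cb <-]; exists (a + b); last by rewrite mulrDr.
    exact: measurable_funD.
  + move=> l _ _ [a Ca <-]; exists (l *: a).
      exact: measurable_funM.
    by apply: bmfun_ext => x; rewrite !(bmfunM, bmfunZ) mulrCA.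
  have L0 eta : bmfun_sub C eta -> L ((xi - etat) * eta) = 0.
    move=> Ceta; apply/eqP; rewrite eq_le LV ?andbT; last by exists eta.
    (* [V] is a subspace, so [L >= 0] on [V] applies to [- eta] as well. *)
    rewrite -oppr_ge0 -raddfN -mulrN LV//; exists (- eta) => //.
    exact: measurable_funN.
  exists L; split=> //.
  have [P PL] := dominated_expectation hrho Lrho hcont.
  exists P; split=> //; split=> // A CA; have mA := hC.2 _ CA.
  have LE := is_expectationE PL.
  rewrite -!bm_expectation_setI// -!LE; congr EFin.
  apply/esym/eqP; rewrite -subr_eq0 -raddfB -mulrBl; apply/eqP/L0.
  exact: C_indic.
- move=> [L [Lrho [P [PL [Cetat condE]]]]]; split=> //.
  have LE := is_expectationE PL.
  have L0 eta : bmfun_sub C eta -> L ((xi - etat) * eta) = 0.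
    apply: (@vanish_bmfun_sub _ _ _ C (scalar_of (mul_linear L (xi - etat)))).
    + exact: hC.
    + exact: (dominated_mul_vanish hrho Lrho hcont).
    + move=> A CA /=; have mA := hC.2 _ CA.
      rewrite mulrBl raddfB /= !LE; apply/eqP; rewrite subr_eq0; apply/eqP.
      by apply: EFin_inj; rewrite !bm_expectation_setI// condE.
  apply/eqP; rewrite eq_le; apply/andP; split.
    apply: ereal_inf_lbound; exists 0; first exact: measurable_cst.
    by rewrite mulr0 (sublinear0 srho).
  apply: le_ereal_inf_tmp => _ [eta Ceta <-].
  by rewrite lee_fin -(L0 _ Ceta).
Qed.
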